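(* Let $(\alpha_1,\alpha_2,\alpha_3)\in\mathbb R^3$ with $\alpha_1^2+\alpha_2^2+\alpha_3^2=1$, $\beta\in\mathbb R$, $t\in\mathbb R$, and put $$\mu_1=t,\quad\nu_1=t^2/2\quad\text{if }(\beta+\alpha_2)^2=1-\alpha_2^2;$$ $$\mu_1=\frac{\sinh\left(t\sqrt{1-\alpha_2^2-(\beta+\alpha_2)^2}\right)}{\sqrt{1-\alpha_2^2-(\beta+\alpha_2)^2}},\quad \nu_1=\frac{\cosh\left(t\sqrt{1-\alpha_2^2-(\beta+\alpha_2)^2}\right)-1}{1-\alpha_2^2-(\beta+\alpha_2)^2}\quad\text{if }(\beta+\alpha_2)^2<1-\alpha_2^2;$$ $$\mu_1=\frac{\sin\left(t\sqrt{(\beta+\alpha_2)^2+\alpha_2^2-1}\right)}{\sqrt{(\beta+\alpha_2)^2+\alpha_2^2-1}},\quad \nu_1=\frac{1-\cos\left(t\sqrt{(\beta+\alpha_2)^2+\alpha_2^2-1}\right)}{(\beta+\alpha_2)^2+\alpha_2^2-1}\quad\text{if }(\beta+\alpha_2)^2>1-\alpha_2^2.$$ If $\alpha_2\ne\pm1$, then the geodesic $\gamma_1(\alpha_1,\alpha_2,\alpha_3,\beta;t)$, $t\in\mathbb R$, of the sub-Riemannian space $(SO_0(2,1)\times\mathbb R,\rho_1)$ is equal to $(C,v)(t)$, where $v(t)=\alpha_2t$ and the columns $C_j(t)$, $j=1,2,3$, of the matrix $C(t)\in SO_0(2,1)$ have the form $$C_1(t)=\begin{pmatrix}1+\nu_1(1-\alpha_2^2)\\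 \sqrt{1-\alpha_2^2}\,(\mu_1\cos\varphi_0-(\beta+\alpha_2)\nu_1\sin\varphi_0)\\ \sqrt{1-\alpha_2^2}\,(\mu_1\sin\varphi_0+(\beta+\alpha_2)\nu_1\cos\varphi_0)\end{pmatrix},$$ $$C_2(t)=\begin{pmatrix}\sqrt{1-\alpha_2^2}\,(\mu_1\cos(\beta t+\varphi_0)+(\beta+\alpha_2)\nu_1\sin(\beta t+\varphi_0))\\ (1-(\beta+\alpha_2)^2\nu_1)\cos\beta t+(\beta+\alpha_2)\mu_1\sin\beta t+(1-\alpha_2^2)\nu_1\cos(\beta t+\varphi_0)\cos\varphi_0\\ -(1-(\beta+\alpha_2)^2\nu_1)\sin\beta t+(\beta+\alpha_2)\mu_1\cos\beta t+(1-\alpha_2^2)\nu_1\cos(\beta t+\varphi_0)\sin\varphi_0\end{pmatrix},$$ $$C_3(t)=\begin{pmatrix}\sqrt{1-\alpha_2^2}\,(\mu_1\sin(\beta t+\varphi_0)-(\beta+\alpha_2)\nu_1\cos(\beta t+\varphi_0))\\ (1-(\beta+\alpha_2)^2\nu_1)\sin\beta t-(\beta+\alpha_2)\mu_1\cos\beta t+(1-\alpha_2^2)\nu_1\sin(\beta t+\varphi_0)\cos\varphi_0\\ (1-(\beta+\alpha_2)^2\nu_1)\cos\beta t+(\beta+\alpha_2)\mu_1\sin\beta t+(1-\alpha_2^2)\nu_1\sin(\beta t+\varphi_0)\sin\varphi_0\end{pmatrix},$$ where $\alpha_1=\sqrt{1-\alpha_2^2}\sin\varphi_0$, $\alpha_3=\sqrt{1-\alpha_2^2}\cos\varphi_0$.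 If $\alpha_2=\pm1$, then this geodesic is equal to $\gamma_1(t)=(C,v)(t)$, $t\in\mathbb R$, where $v(t)=\alpha_2t$ and $$C(t)=\begin{pmatrix}1&0&0\\0&\cos\alpha_2t&-\sin\alpha_2t\\0&\sin\alpha_2t&\cos\alpha_2t\end{pmatrix}.$$
   Context: $SO_0(2,1)=\{g\in GL(3,\mathbb R)\mid g^TJg=J,\ \det g=1,\ g_{11}>0\}$ with $J=\mathrm{diag}(-1,1,1)$. $SO_0(2,1)\times\mathbb R$ is the group of $4\times4$ block-diagonal matrices $(C,v):=\mathrm{diag}(C,e^v)$ with $C\in SO_0(2,1)$, $v\in\mathbb R$. Its Lie algebra has basis $E_1=e_{13}+e_{31}$, $E_2=e_{12}+e_{21}$, $E_3=e_{23}-e_{32}$, $E_4=e_{44}$ ($e_{ij}$ with double indices are $4\times4$ matrix units). Put $e_1=E_1$, $e_2=E_4-E_3$, $e_3=E_2$, $e_4=-E_3$. $\rho_1$ is the left-invariant sub-Riemannian metric defined by the left-invariant distribution with value $\mathrm{span}(e_1,e_2,e_3)$ at the unit $\mathrm{Id}$ and the inner product with orthonormal basis $e_1,e_2,e_3$. The arclength-parametrized geodesics of $\rho_1$ starting at $\mathrm{Id}$ are the curves $\gamma_1(\alpha_1,\alpha_2,\alpha_3,\beta;t)=\exp(t(\alpha_1e_1+\alpha_2e_2+\alpha_3e_3+\beta e_4))\exp(-t\beta e_4)$ with $\alpha_1^2+\alpha_2^2+\alpha_3^2=1$, $\beta\in\mathbb R$. *)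

(* Defs.v *)
From HB Require Import structures.
From mathcomp Require Import all_boot all_order all_algebra.
From mathcomp Require Import all_classical all_reals all_analysis.

Set Implicit Arguments.
Unset Strict Implicit.
Unset Printing Implicit Defensive.

Import Order.TTheory GRing.Theory Num.Theory.
Import numFieldNormedType.Exports.

Local Open Scope classical_set_scope.
Local Open Scope ring_scope.

Section SO21xR.
Context {R : realType}.

Definition sinh (x : R) : R := (expR x - expR (- x)) / 2.
Definition cosh (x : R) : R := (expR x + expR (- x)) / 2.

(* The limit is taken in the normed space 'M[R]_n.+1, where this series
   converges for every A, so [lim] never takes its default value. *)
Definition expmx (n : nat) (A : 'M[R]_n.+1) : 'M[R]_n.+1 :=
  limn (series (fun k => (k`!%:R)^-1 *: A ^+ k)).

Definition J : 'M[R]_3 := diag_mx (\row_(i < 3) [:: -1; 1; 1]`_i).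

Definition in_SO021 (C : 'M[R]_3) : Prop :=
  [/\ C^T *m J *m C = J, \det C = 1 & 0 < C 0 0].

(* The element (C, v) = diag(C, e^v); 3 + 1 and 4 are convertible. *)
Definition elt (C : 'M[R]_3) (v : R) : 'M[R]_4 :=
  block_mx C 0 0 (expR v)%:M : 'M[R]_(3 + 1).

(* The matrix unit e_ij, with i and j counted from 1. *)
Definition munit (i j : nat) : 'M[R]_4 := delta_mx (inord i.-1) (inord j.-1).

Definition E1 : 'M[R]_4 := munit 1 3 + munit 3 1.
Definition E2 : 'M[R]_4 := munit 1 2 + munit 2 1.
Definition E3 : 'M[R]_4 := munit 2 3 - munit 3 2.
Definition E4 : 'M[R]_4 := munit 4 4.

Definition e1 : 'M[R]_4 := E1.
Definition e2 : 'M[R]_4 := E4 - E3.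
Definition e3 : 'M[R]_4 := E2.
Definition e4 : 'M[R]_4 := - E3.

(* The arclength-parametrized geodesics issuing from Id of the left-invariant
   sub-Riemannian metric with orthonormal frame e1, e2, e3 are these curves,
   for a1 ^+ 2 + a2 ^+ 2 + a3 ^+ 2 = 1 and arbitrary b. *)
Definition gamma1 (a1 a2 a3 b t : R) : 'M[R]_4 :=
  expmx (t *: (a1 *: e1 + a2 *: e2 + a3 *: e3 + b *: e4))
  *m expmx (- (t * b) *: e4).

Definition mu1 (a2 b t : R) : R :=
  if (b + a2) ^+ 2 == 1 - a2 ^+ 2 then t
  else if (b + a2) ^+ 2 < 1 - a2 ^+ 2 then
    sinh (t * Num.sqrt (1 - a2 ^+ 2 - (b + a2) ^+ 2))
      / Num.sqrt (1 - a2 ^+ 2 - (b + a2) ^+ 2)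
  else
    sin (t * Num.sqrt ((b + a2) ^+ 2 + a2 ^+ 2 - 1))
      / Num.sqrt ((b + a2) ^+ 2 + a2 ^+ 2 - 1).

Definition nu1 (a2 b t : R) : R :=
  if (b + a2) ^+ 2 == 1 - a2 ^+ 2 then t ^+ 2 / 2
  else if (b + a2) ^+ 2 < 1 - a2 ^+ 2 then
    (cosh (t * Num.sqrt (1 - a2 ^+ 2 - (b + a2) ^+ 2)) - 1)
      / (1 - a2 ^+ 2 - (b + a2) ^+ 2)
  else
    (1 - cos (t * Num.sqrt ((b + a2) ^+ 2 + a2 ^+ 2 - 1)))
      / ((b + a2) ^+ 2 + a2 ^+ 2 - 1).

Definition vec3 (x y z : R) : 'cV[R]_3 := \col_(i < 3) [:: x; y; z]`_i.

End SO21xR.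

(* Main.v *)
Require Import Defs.
From HB Require Import structures.
From mathcomp Require Import all_boot all_order all_algebra.
From mathcomp Require Import all_classical all_reals all_analysis.
From mathcomp Require Import ring lra.

Set Implicit Arguments.
Unset Strict Implicit.
Unset Printing Implicit Defensive.

Import Order.TTheory GRing.Theory Num.Theory.
Import numFieldNormedType.Exports.

Local Open Scope classical_set_scope.
Local Open Scope ring_scope.

(** The generator [a1 e1 + a2 e2 + a3 e3 + b e4] is block diagonal, with blocks
    a matrix [B] of so(2,1) and the scalar [a2].  With [w := b + a2], the
    eigenvalues of [B] are [0] and the square roots of
    [k := a1 ^+ 2 + a3 ^+ 2 - w ^+ 2], so that [B ^+ 3 = k B] and the powers of
    [B] reduce to [B] (odd powers) and [B ^+ 2] (even ones).  Collecting them
    in the exponential series gives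
      [exp (t B) = 1 + mu B + nu B ^+ 2],
    where [mu] and [nu] are the sums of [k ^+ m t ^+ (2 m + 1) / (2 m + 1)`!]
    and of [k ^+ m t ^+ (2 m + 2) / (2 m + 2)`!].  By the unit length
    hypothesis [k = 1 - a2 ^+ 2 - (b + a2) ^+ 2], and these sums are the
    hyperbolic, trigonometric or polynomial expressions of the statement
    according to the sign of [k] (lemmas [cvg_series_gsin], [cvg_series_gver]
    and [expmx_bdiag]).

    The second factor of the geodesic is a special case of the first one,
    with [a1 = a2 = a3 = 0]; its block in so(2,1) exponentiates to a rotation
    of angle [- b t] ([exp_so21_rot]).  Multiplying the two blocks
    ([gamma1E]) gives the announced columns, after writing
    [(a3, a1) = s (cos phi0, sin phi0)] and expanding the sines and cosines of
    [b t + phi0].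

    That the block lies in the identity component of SO(2,1) rests on two
    properties of [mu] and [nu]: the identity
    [mu ^+ 2 = 2 nu + k nu ^+ 2], which is [cosh ^+ 2 - sinh ^+ 2 = 1] or
    [cos ^+ 2 + sin ^+ 2 = 1] in disguise, makes [exp (t B)] a Lorentz isometry
    of determinant one; and [0 <= nu] makes its upper left entry
    [1 + nu (1 - a2 ^+ 2)] positive.  When [a2] is [1] or [-1], [a1] and [a3]
    vanish, both factors are rotations and their angles add up to [a2 t]. *)

(** * Convergent series *)

Lemma cvg_series_eventually0 (R : realType) (V : normedModType R)
    (u : nat -> V) (N : nat) :
  (forall k, (N <= k)%N -> u k = 0) -> series u @ \oo --> series u N.
Proof.
move=> u0; apply: cvg_near_cst; near=> n.
have Nn : (N <= n)%N by near: n; exists N.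
apply/eqP; rewrite -subr_eq0 sub_series_geq// big_nat_cond big1// => k.
by rewrite andbT => /andP[/u0].
Unshelve. all: by end_near. Qed.

Lemma cvg_seriesD (R : realType) (V : normedModType R) (u v : nat -> V) a b :
  series u @ \oo --> a -> series v @ \oo --> b ->
  series (u + v) @ \oo --> a + b.
Proof. by rewrite seriesD; exact: cvgD. Qed.

Lemma cvg_seriesZl (R : realType) (V : normedModType R) (c : R)
    (u : nat -> V) a :
  series u @ \oo --> a -> series (c *: u) @ \oo --> c *: a.
Proof. by rewrite seriesZ; exact: cvgZl_tmp. Qed.

Lemma cvg_seriesZr (R : realType) (V : normedModType R) (u : nat -> R)
    (l : R) (A : V) :
  series u @ \oo --> l -> series (fun k => u k *: A) @ \oo --> l *: A.
Proof.
rewrite (_ : series (fun k => _) = fun n => series u n *: A).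
  exact: cvgZr_tmp.
by apply/funext => n; rewrite /series/= scaler_suml.
Qed.

Lemma cvg_series_expR (R : realType) (x : R) :
  series (exp_coeff x) @ \oo --> expR x.
Proof. by rewrite /expR; exact: is_cvg_series_exp_coeff. Qed.

Lemma cvg_series_sin (R : realType) (x : R) :
  series (sin_coeff x) @ \oo --> sin x.
Proof. by rewrite unlock; exact: is_cvg_series_sin_coeff. Qed.

Lemma cvg_series_cos (R : realType) (x : R) :
  series (cos_coeff x) @ \oo --> cos x.
Proof. by rewrite unlock; exact: is_cvg_series_cos_coeff. Qed.

(** * The generalized sine and versine *)

(** The solution of [y'' = k y] with [y 0 = 0] and [y' 0 = 1]. *)
Definition gsin (R : realType) (k t : R) : R :=
  if k == 0 then t
  else if 0 < k then sinh (t * Num.sqrt k) / Num.sqrt k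
  else sin (t * Num.sqrt (- k)) / Num.sqrt (- k).

(** The primitive of [gsin k] that vanishes at [0]; for [k = -1] it is the
    versine [1 - cos t]. *)
Definition gver (R : realType) (k t : R) : R :=
  if k == 0 then t ^+ 2 / 2
  else if 0 < k then (cosh (t * Num.sqrt k) - 1) / k
  else (1 - cos (t * Num.sqrt (- k))) / - k.

(** The coefficient of [A] in [t ^+ n / n`! A ^+ n] when [A ^+ 3 = k A]: as
    [n] is odd, [n./2] is [(n - 1) / 2]. *)
Definition gsin_coeff (R : realType) (k t : R) (n : nat) : R :=
  if odd n then k ^+ n./2 * (t ^+ n / n`!%:R) else 0.

(** The coefficient of [A ^+ 2] in [t ^+ n / n`! A ^+ n] when [A ^+ 3 = k A]. *)
Definition gver_coeff (R : realType) (k t : R) (n : nat) : R :=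
  if odd n || (n == 0%N) then 0 else k ^+ n./2.-1 * (t ^+ n / n`!%:R).

Lemma parity_ind (P : nat -> Prop) :
  (forall m, P m.*2) -> (forall m, P m.*2.+1) -> forall n, P n.
Proof.
move=> Pe Po n; rewrite -(odd_double_half n).
by case: odd; [exact: Po|exact: Pe].
Qed.

Lemma natr_fact_neq0 (R : realType) (n : nat) : (n`!%:R : R) != 0.
Proof. by rewrite pnatr_eq0 -lt0n fact_gt0. Qed.

Lemma cvg_series_delta0 (R : realType) :
  series (fun n => (n == 0%N)%:R : R) @ \oo --> (1 : R).
Proof.
have /cvg_series_eventually0 :
    forall n, (1 <= n)%N -> (n == 0%N)%:R = 0 :> R by case.
by rewrite /series/= big_nat1.
Qed.

(** For [k = r ^+ 2], [k ^+ m t ^+ (2 m + 1)] is [(t r) ^+ (2 m + 1) / r]: up to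
    the factor [r^-1] this is the series of [sinh] at [t r], the odd part of the
    exponential series.  The same rescaling underlies [cvg_series_gsin_neg],
    [cvg_series_gver_pos] and [cvg_series_gver_neg]. *)
Lemma cvg_series_gsin_pos (R : realType) (r t : R) : r != 0 ->
  series (gsin_coeff (r ^+ 2) t) @ \oo --> sinh (t * r) / r.
Proof.
move=> r0.
rewrite (_ : gsin_coeff _ t =
    (2 * r)^-1 *: (exp_coeff (t * r) + - 1 *: exp_coeff (- (t * r)))).
  rewrite (_ : _ / r = (2 * r)^-1 *: (expR (t * r) + - 1 *: expR (- (t * r)))).
    by apply: cvg_seriesZl; apply: cvg_seriesD; [|apply: cvg_seriesZl];
      exact: cvg_series_expR.
  by rewrite /sinh /GRing.scale/=; field.
apply/funext; elim/parity_ind => m;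
  rewrite /gsin_coeff /exp_coeff !fctE/= odd_double /GRing.scale/=
    exprNn -signr_odd/= odd_double /=.
  by rewrite mul1r; ring.
rewrite uphalf_double -exprM mul2n !exprMn [r ^+ _.+1]exprS.
have := natr_fact_neq0 R m.*2.+1; move: (_%:R) => f f0.
by rewrite expr1; field; rewrite r0 f0.
Qed.

Lemma cvg_series_gsin_neg (R : realType) (r t : R) : r != 0 ->
  series (gsin_coeff (- r ^+ 2) t) @ \oo --> sin (t * r) / r.
Proof.
move=> r0.
rewrite mulrC (_ : gsin_coeff _ t = r^-1 *: sin_coeff (t * r)).
  by apply: cvg_seriesZl; exact: cvg_series_sin.
apply/funext; elim/parity_ind => m;
  rewrite /gsin_coeff /sin_coeff !fctE/= odd_double /GRing.scale/=.
  by ring.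
rewrite uphalf_double doubleK [(- _ ^+ 2) ^+ _]exprNn -exprM mul2n !exprMn.
have := natr_fact_neq0 R m.*2.+1; move: (_%:R) => f f0.
by rewrite [r ^+ _.+1]exprS; field; rewrite r0 f0.
Qed.

Lemma cvg_series_gver_pos (R : realType) (r t : R) : r != 0 ->
  series (gver_coeff (r ^+ 2) t) @ \oo --> (cosh (t * r) - 1) / r ^+ 2.
Proof.
move=> r0.
rewrite (_ : gver_coeff _ t = (r ^+ 2)^-1 *:
    (2^-1 *: (exp_coeff (t * r) + exp_coeff (- (t * r)))
     + - 1 *: (fun n => (n == 0%N)%:R))).
  rewrite (_ : _ / r ^+ 2 = (r ^+ 2)^-1 *:
      (2^-1 *: (expR (t * r) + expR (- (t * r))) + - 1 *: 1)).
    apply: cvg_seriesZl; apply: cvg_seriesD.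
      by apply: cvg_seriesZl; apply: cvg_seriesD; exact: cvg_series_expR.
    by apply: cvg_seriesZl; exact: cvg_series_delta0.
  by rewrite /cosh /GRing.scale/=; field.
apply/funext; elim/parity_ind => [[|m]|m];
  rewrite /gver_coeff /exp_coeff !fctE/= ?odd_double /GRing.scale/=
    exprNn -signr_odd/= ?odd_double /= ?doubleK.
- by rewrite !(double0, fact0, expr0); field.
- rewrite -exprM mul2n !exprMn.
  have := natr_fact_neq0 R m.*2.+2; move: (_%:R) => f f0.
  by rewrite doubleS !exprS; field; rewrite r0 f0.
- by ring.
Qed.

Lemma cvg_series_gver_neg (R : realType) (r t : R) : r != 0 ->
  series (gver_coeff (- r ^+ 2) t) @ \oo --> (1 - cos (t * r)) / r ^+ 2.
Proof.
move=> r0.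
rewrite (_ : gver_coeff _ t = (r ^+ 2)^-1 *:
    ((fun n => (n == 0%N)%:R) + - 1 *: cos_coeff (t * r))).
  rewrite (_ : _ / r ^+ 2 = (r ^+ 2)^-1 *: (1 + - 1 *: cos (t * r))).
    apply: cvg_seriesZl; apply: cvg_seriesD; first exact: cvg_series_delta0.
    by apply: cvg_seriesZl; exact: cvg_series_cos.
  by rewrite /GRing.scale/=; field.
apply/funext; elim/parity_ind => [[|m]|m];
  rewrite /gver_coeff /cos_coeff !fctE/= ?odd_double /GRing.scale/= ?doubleK.
- by rewrite !(double0, fact0, expr0, expr0z); field.
- rewrite -exprnP [_ ^+ m.+1]exprS [(- _ ^+ 2) ^+ _]exprNn -exprM mul2n !exprMn.
  have := natr_fact_neq0 R m.*2.+2; move: (_%:R) => f f0.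
  by rewrite doubleS !exprS; field; rewrite r0 f0.
- by ring.
Qed.

(** In each sign case the root [r] is what the closed forms of [gsin] and
    [gver] contain, so that no square root is left in the proofs. *)
Lemma real_square_ind (R : realType) (P : R -> Prop) :
  P 0 -> (forall r, 0 < r -> P (r ^+ 2)) -> (forall r, 0 < r -> P (- r ^+ 2)) ->
  forall k, P k.
Proof.
move=> P0 Pp Pn k; case: (ltgtP k 0) => [k0|k0|->//].
- rewrite -[k]opprK -[- k]sqr_sqrtr ?oppr_ge0 ?ltW//.
  by apply: Pn; rewrite sqrtr_gt0 oppr_gt0.
- by rewrite -[k]sqr_sqrtr ?ltW//; apply: Pp; rewrite sqrtr_gt0.
Qed.

Lemma gsin_sqr (R : realType) (r t : R) : 0 < r ->
  gsin (r ^+ 2) t = sinh (t * r) / r.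
Proof.
by move=> r0; rewrite /gsin sqrf_eq0 gt_eqF// exprn_gt0// sqrtr_sqr gtr0_norm.
Qed.

Lemma gsin_Nsqr (R : realType) (r t : R) : 0 < r ->
  gsin (- r ^+ 2) t = sin (t * r) / r.
Proof.
move=> r0; rewrite /gsin oppr_eq0 sqrf_eq0 gt_eqF// oppr_gt0 ltNge sqr_ge0/=.
by rewrite opprK sqrtr_sqr gtr0_norm.
Qed.

Lemma gver_sqr (R : realType) (r t : R) : 0 < r ->
  gver (r ^+ 2) t = (cosh (t * r) - 1) / r ^+ 2.
Proof.
by move=> r0; rewrite /gver sqrf_eq0 gt_eqF// exprn_gt0// sqrtr_sqr gtr0_norm.
Qed.

Lemma gver_Nsqr (R : realType) (r t : R) : 0 < r ->
  gver (- r ^+ 2) t = (1 - cos (t * r)) / r ^+ 2.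
Proof.
move=> r0; rewrite /gver oppr_eq0 sqrf_eq0 gt_eqF// oppr_gt0 ltNge sqr_ge0/=.
by rewrite opprK sqrtr_sqr gtr0_norm.
Qed.

Lemma cvg_series_gsin (R : realType) (k t : R) :
  series (gsin_coeff k t) @ \oo --> gsin k t.
Proof.
elim/real_square_ind: k => [|r r0|r r0].
- have /cvg_series_eventually0 : forall n, (2 <= n)%N -> gsin_coeff 0 t n = 0.
    by case=> [|[|n]]// _; rewrite /gsin_coeff/= exprS !mul0r if_same.
  rewrite /gsin eqxx /series/= big_nat_recr// big_nat1 /gsin_coeff /=.
  by rewrite expr0 expr1 invr1 mulr1 mul1r add0r.
- by rewrite gsin_sqr//; apply: cvg_series_gsin_pos; rewrite gt_eqF.
- by rewrite gsin_Nsqr//; apply: cvg_series_gsin_neg; rewrite gt_eqF.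
Qed.

Lemma cvg_series_gver (R : realType) (k t : R) :
  series (gver_coeff k t) @ \oo --> gver k t.
Proof.
elim/real_square_ind: k => [|r r0|r r0].
- have /cvg_series_eventually0 : forall n, (3 <= n)%N -> gver_coeff 0 t n = 0.
    (* the exponent of [0] is positive only from [n = 4] on; [n = 3] is odd *)
    by case=> [|[|[|[|n]]]]// _; rewrite /gver_coeff/= exprS !mul0r if_same.
  rewrite /gver eqxx /series/= !big_nat_recr//= big_nil /gver_coeff /= expr0.
  by rewrite mul1r !add0r.
- by rewrite gver_sqr//; apply: cvg_series_gver_pos; rewrite gt_eqF.
- by rewrite gver_Nsqr//; apply: cvg_series_gver_neg; rewrite gt_eqF.
Qed.

(** The identity [sinh ^+ 2 = cosh ^+ 2 - 1 = (cosh - 1) (cosh + 1)], and its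
    trigonometric analogue, rescaled by the root of [k]. *)
Lemma gsin_gver (R : realType) (k t : R) :
  gsin k t ^+ 2 = 2 * gver k t + k * gver k t ^+ 2.
Proof.
elim/real_square_ind: k => [|r r0|r r0].
- by rewrite /gsin /gver eqxx; field.
- rewrite gsin_sqr// gver_sqr// /sinh /cosh expRN; field.
  by rewrite (gt_eqF r0) (gt_eqF (expR_gt0 _)).
- rewrite gsin_Nsqr// gver_Nsqr//; have := cos2Dsin2 (t * r).
  move: (cos _) (sin _) => c s /eqP; rewrite eq_sym addrC -subr_eq => /eqP cs.
  by rewrite expr_div_n -cs; field; rewrite gt_eqF.
Qed.

Lemma gver_ge0 (R : realType) (k t : R) : 0 <= gver k t.
Proof.
elim/real_square_ind: k => [|r r0|r r0].
- by rewrite /gver eqxx divr_ge0// sqr_ge0.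
- rewrite gver_sqr// divr_ge0 ?sqr_ge0// /cosh.
  have := expR_ge1Dx (t * r); have := expR_ge1Dx (- (t * r)); lra.
- by rewrite gver_Nsqr// divr_ge0 ?sqr_ge0// subr_ge0 cos_le1.
Qed.

(** * Exponentials of block diagonal matrices *)

Lemma expr_odd_cubic (R : comNzRingType) (V : algType R) (A : V) (k : R)
    (m : nat) :
  A ^+ 3 = k *: A -> A ^+ m.*2.+1 = k ^+ m *: A.
Proof.
move=> A3; elim: m => [|m IHm]; first by rewrite scale1r.
rewrite (_ : m.+1.*2.+1 = (m.*2.+1 + 2)%N); last by rewrite addn2.
by rewrite exprD IHm -scalerAl -exprS A3 scalerA exprSr.
Qed.

Lemma expr_even_cubic (R : comNzRingType) (V : algType R) (A : V) (k : R)
    (m : nat) :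
  A ^+ 3 = k *: A -> A ^+ m.*2.+2 = k ^+ m *: A ^+ 2.
Proof. by move=> A3; rewrite exprS (expr_odd_cubic _ A3) -scalerAr. Qed.

Section BlockExponential.
Context {R : realType}.

(** The matrix [elt C v] is [bdiag C (expR v)] by conversion.  Letting the last
    block vanish gives the singular matrices that occur as coefficients in the
    exponential series. *)
Definition bdiag (A : 'M[R]_3) (c : R) : 'M[R]_4 :=
  block_mx A 0 0 c%:M : 'M[R]_(3 + 1).

Lemma bdiagM (A B : 'M[R]_3) (c d : R) :
  bdiag A c *m bdiag B d = bdiag (A *m B) (c * d).
Proof.
apply: etrans (mulmx_block A 0 0 c%:M B 0 0 d%:M) _.
by rewrite !mulmx0 !mul0mx !addr0 !add0r -scalar_mxM.
Qed.

Lemma bdiagD (A B : 'M[R]_3) (c d : R) :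
  bdiag A c + bdiag B d = bdiag (A + B) (c + d).
Proof.
apply: etrans (add_block_mx A 0 0 c%:M B 0 0 d%:M) _.
by rewrite !addr0 -raddfD.
Qed.

Lemma bdiagZ (a : R) (A : 'M[R]_3) (c : R) :
  a *: bdiag A c = bdiag (a *: A) (a * c).
Proof.
apply: etrans (scale_block_mx a A 0 0 c%:M) _.
by rewrite !scaler0 scale_scalar_mx.
Qed.

Lemma bdiag1 : bdiag 1 1 = 1.
Proof. exact: esym (scalar_mx_block 3 1 1). Qed.

Lemma bdiagX (A : 'M[R]_3) (c : R) n : bdiag A c ^+ n = bdiag (A ^+ n) (c ^+ n).
Proof.
by elim: n => [|n IHn]; rewrite ?bdiag1// !exprS IHn [LHS]bdiagM.
Qed.

(** Each term of the exponential series is a combination of the four constant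
    matrices [bdiag 1 0], [bdiag A 0], [bdiag (A ^+ 2) 0] and [bdiag 0 1], so
    convergence in the matrix space reduces to that of four scalar series. *)
Lemma expmx_bdiag (A : 'M[R]_3) (k t c : R) : A ^+ 3 = k *: A ->
  expmx (bdiag (t *: A) c) =
  bdiag (1 + gsin k t *: A + gver k t *: A ^+ 2) (expR c).
Proof.
move=> A3; apply: cvg_lim => //.
rewrite (_ : (fun n => _) =
   ((fun n => (n == 0%N)%:R *: bdiag 1 0)
    + (fun n => gsin_coeff k t n *: bdiag A 0))
   + (fun n => gver_coeff k t n *: bdiag (A ^+ 2) 0)
   + (fun n => exp_coeff c n *: bdiag 0 1)).
  rewrite (_ : bdiag _ (expR c) = 1 *: bdiag 1 0 + gsin k t *: bdiag A 0
      + gver k t *: bdiag (A ^+ 2) 0 + expR c *: bdiag 0 1).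
    apply: cvg_seriesD; first apply: cvg_seriesD; first apply: cvg_seriesD;
      apply: cvg_seriesZr.
    - exact: cvg_series_delta0.
    - exact: cvg_series_gsin.
    - exact: cvg_series_gver.
    - exact: cvg_series_expR.
  rewrite !(bdiagZ, bdiagD); congr bdiag; last by rewrite !mulr0 !add0r mulr1.
  by rewrite scale1r scaler0 addr0.
apply/funext => n; rewrite !fctE bdiagX !(bdiagZ, bdiagD).
congr bdiag; last first.
  by rewrite !mulr0 !add0r mulr1 mulrC.
rewrite scaler0 addr0 exprZn scalerA.
elim/parity_ind: n => [[|m]|m]; rewrite /gsin_coeff /gver_coeff ?odd_double/=.
- by rewrite !scale0r !addr0 invr1 mulr1.
- rewrite !scale0r !add0r doubleK doubleS (expr_even_cubic _ A3).
  by rewrite scalerA; congr (_ *: _); ring.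
- rewrite odd_double/= !scale0r add0r addr0 uphalf_double (expr_odd_cubic _ A3).
  by rewrite scalerA; congr (_ *: _); ring.
Qed.

End BlockExponential.

(** * The group SO(2,1) *)

Section Lorentz.
Context {R : realType}.
Implicit Types p q w t k : R.

Definition mx3 (a b c d e f g h i : R) : 'M[R]_3 :=
  \matrix_(x, y)
    nth 0 (nth [::] [:: [:: a; b; c]; [:: d; e; f]; [:: g; h; i]] x) y.

Lemma mx3M a b c d e f g h i a' b' c' d' e' f' g' h' i' :
  mx3 a b c d e f g h i *m mx3 a' b' c' d' e' f' g' h' i' =
  mx3 (a * a' + b * d' + c * g') (a * b' + b * e' + c * h')
      (a * c' + b * f' + c * i')
      (d * a' + e * d' + f * g') (d * b' + e * e' + f * h')
      (d * c' + e * f' + f * i')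
      (g * a' + h * d' + i * g') (g * b' + h * e' + i * h')
      (g * c' + h * f' + i * i').
Proof.
by apply/matrixP => -[[|[|[|//]]] ?] [[|[|[|//]]] ?];
  rewrite !mxE !big_ord_recl big_ord0 !mxE/= addr0 addrA.
Qed.

Lemma mx3D a b c d e f g h i a' b' c' d' e' f' g' h' i' :
  mx3 a b c d e f g h i + mx3 a' b' c' d' e' f' g' h' i' =
  mx3 (a + a') (b + b') (c + c') (d + d') (e + e') (f + f')
      (g + g') (h + h') (i + i').
Proof.
by apply/matrixP => -[[|[|[|//]]] ?] [[|[|[|//]]] ?]; rewrite !mxE.
Qed.

Lemma mx3Z z a b c d e f g h i :
  z *: mx3 a b c d e f g h i =
  mx3 (z * a) (z * b) (z * c) (z * d) (z * e) (z * f) (z * g) (z * h) (z * i).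
Proof.
by apply/matrixP => -[[|[|[|//]]] ?] [[|[|[|//]]] ?]; rewrite !mxE.
Qed.

Lemma mx3_1 : 1 = mx3 1 0 0 0 1 0 0 0 1.
Proof.
by apply/matrixP => -[[|[|[|//]]] ?] [[|[|[|//]]] ?]; rewrite !mxE.
Qed.

Lemma mx3_J : J = mx3 (-1) 0 0 0 1 0 0 0 1.
Proof.
by apply/matrixP => -[[|[|[|//]]] ?] [[|[|[|//]]] ?]; rewrite !mxE.
Qed.

Lemma tr_mx3 a b c d e f g h i :
  (mx3 a b c d e f g h i)^T = mx3 a d g b e h c f i.
Proof.
by apply/matrixP => -[[|[|[|//]]] ?] [[|[|[|//]]] ?]; rewrite !mxE.
Qed.

Lemma col_mx3 a b c d e f g h i (C := mx3 a b c d e f g h i) :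
  (col 0 C = vec3 a d g) * (col 1 C = vec3 b e h) * (col 2 C = vec3 c f i).
Proof.
by split; first split; apply/matrixP => -[[|[|[|//]]] ?] j; rewrite !mxE.
Qed.

Lemma det_mx3 a b c d e f g h i :
  \det (mx3 a b c d e f g h i) =
  a * (e * i - f * h) - b * (d * i - f * g) + c * (d * h - e * g).
Proof.
rewrite (expand_det_row _ 0) !big_ord_recl big_ord0 /cofactor.
rewrite !(expand_det_row _ 0) !big_ord_recl !big_ord0 /cofactor.
rewrite !det_mx11 !mxE/=.
by ring.
Qed.

(** The general element of the Lie algebra so(2,1): [p E1 + q E2 - w E3]. *)
Definition so21mx p q w : 'M[R]_3 := mx3 0 q p q 0 (- w) p w 0.

Definition rot t : 'M[R]_3 := mx3 1 0 0 0 (cos t) (- sin t) 0 (sin t) (cos t).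

(** Both [a2 e2] and [b e4] contribute to the rotation part, hence [b + a2]. *)
Lemma geodesic_generator (a1 a2 a3 b t : R) :
  t *: (a1 *: e1 + a2 *: e2 + a3 *: e3 + b *: e4) =
  bdiag (t *: so21mx a1 a3 (b + a2)) (t * a2).
Proof.
apply/matrixP => i j.
case: (@split_ordP 3 1 i) => i' ->; case: (@split_ordP 3 1 j) => j' ->.
- rewrite [RHS]block_mxEul !mxE -!val_eqE/= !inordK//.
  by case: i' => [[|[|[|//]]] ?]; case: j' => [[|[|[|//]]] ?] /=; ring.
- rewrite [RHS]block_mxEur !mxE -!val_eqE/= !inordK//.
  by case: i' => [[|[|[|//]]] ?]; case: j' => [[|//] ?] /=; ring.
- rewrite [RHS]block_mxEdl !mxE -!val_eqE/= !inordK//.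
  by case: j' => [[|[|[|//]]] ?]; case: i' => [[|//] ?] /=; ring.
- rewrite [RHS]block_mxEdr !mxE -!val_eqE/= !inordK//.
  by case: i' => [[|//] ?]; case: j' => [[|//] ?] /=; ring.
Qed.

(** By Cayley-Hamilton: the trace and the determinant of the matrix vanish. *)
Lemma so21_cubic p q w :
  so21mx p q w ^+ 3 = (p ^+ 2 + q ^+ 2 - w ^+ 2) *: so21mx p q w.
Proof.
rewrite [LHS]exprS [so21mx _ _ _ ^+ 2]expr2 -!mulmxE !mx3M mx3Z.
by congr mx3; ring.
Qed.

Definition exp_so21 p q w t :=
  let k := p ^+ 2 + q ^+ 2 - w ^+ 2 in
  1 + gsin k t *: so21mx p q w + gver k t *: so21mx p q w ^+ 2.

Lemma exp_so21E p q w t (k := p ^+ 2 + q ^+ 2 - w ^+ 2)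
    (m := gsin k t) (n := gver k t) :
  exp_so21 p q w t =
  mx3 (1 + n * (p ^+ 2 + q ^+ 2)) (m * q + n * p * w) (m * p - n * q * w)
      (m * q - n * p * w) (1 + n * (q ^+ 2 - w ^+ 2)) (- m * w + n * p * q)
      (m * p + n * q * w) (m * w + n * p * q) (1 + n * (p ^+ 2 - w ^+ 2)).
Proof.
rewrite /exp_so21 -/k -/m -/n [so21mx _ _ _ ^+ 2]expr2.
rewrite -mulmxE mx3M !mx3Z mx3_1 !mx3D.
by congr mx3; ring.
Qed.

Lemma expmx_generator (a1 a2 a3 b t : R) :
  expmx (t *: (a1 *: e1 + a2 *: e2 + a3 *: e3 + b *: e4)) =
  elt (exp_so21 a1 a3 (b + a2) t) (a2 * t).
Proof.
rewrite geodesic_generator (expmx_bdiag _ _ (so21_cubic _ _ _)).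
by rewrite [t * a2]mulrC.
Qed.

(** The closed forms of [gsin] and [gver] at [- w ^+ 2] contain [`|w|]; being
    even in it, they keep their values when it is replaced by [w]. *)
Lemma exp_so21_rot w t : exp_so21 0 0 w t = rot (w * t).
Proof.
rewrite exp_so21E /rot expr0n/= !add0r.
have [->|w0] := eqVneq w 0.
  by rewrite mul0r cos0 sin0; congr mx3; ring.
suff [sE vE] : gsin (- w ^+ 2) t * w = sin (w * t) /\
    gver (- w ^+ 2) t * w ^+ 2 = 1 - cos (w * t).
  rewrite !(mul0r, mulr0, addr0, subr0) -sE.
  by congr mx3; rewrite ?mulNr ?mulrN ?vE; ring.
case: (ltgtP w 0) => [wn|wp|/eqP]; last by rewrite (negbTE w0).
- rewrite -sqrrN gsin_Nsqr ?gver_Nsqr ?oppr_gt0// mulrN sinN cosN [t * w]mulrC.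
  by split; field; rewrite ?oppr_eq0 w0.
- by rewrite gsin_Nsqr// gver_Nsqr// [t * w]mulrC; split; field.
Qed.

Lemma rotM s t : rot s *m rot t = rot (s + t).
Proof. by rewrite mx3M /rot cosD sinD; congr mx3; ring. Qed.

(** Membership in SO(2,1), leaving the connected component aside: products
    obviously preserve these two conditions, while they preserve positivity of
    the upper left entry by a Cauchy-Schwarz inequality. *)
Definition unimodular_isometry (C : 'M[R]_3) := C^T *m J *m C = J /\ \det C = 1.

Lemma unimodular_isometryM (C D : 'M[R]_3) :
  unimodular_isometry C -> unimodular_isometry D ->
  unimodular_isometry (C *m D).
Proof.
move=> [CJ C1] [DJ D1]; split; last by rewrite det_mulmx C1 D1 mulr1.
by rewrite trmx_mul !mulmxA -(mulmxA _ C^T) -(mulmxA _ (C^T *m _)) CJ.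
Qed.

Lemma rot_isometry t : unimodular_isometry (rot t).
Proof.
have cs : cos t ^+ 2 = 1 - sin t ^+ 2 by rewrite -(cos2Dsin2 t) addrK.
split.
  by rewrite tr_mx3 mx3_J !mx3M; congr mx3; ring: cs.
by rewrite det_mx3; ring: cs.
Qed.

(** In both identities the entrywise defect is a multiple of
    [m ^+ 2 - 2 n - k n ^+ 2]. *)
Lemma exp_so21_isometry p q w t : unimodular_isometry (exp_so21 p q w t).
Proof.
rewrite /unimodular_isometry exp_so21E.
have := gsin_gver (p ^+ 2 + q ^+ 2 - w ^+ 2) t.
move: (gsin _ _) (gver _ _) => m n mn; split.
  by rewrite tr_mx3 mx3_J !mx3M; congr mx3; ring: mn.
by rewrite det_mx3; ring: mn.
Qed.

End Lorentz.

(** * Geodesics *)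

Lemma mu1E (R : realType) (a b t : R) :
  mu1 a b t = gsin (1 - a ^+ 2 - (b + a) ^+ 2) t.
Proof.
rewrite /mu1 /gsin subr_eq0 subr_gt0 eq_sym.
by rewrite (_ : - (1 - a ^+ 2 - _) = (b + a) ^+ 2 + a ^+ 2 - 1); last by ring.
Qed.

Lemma nu1E (R : realType) (a b t : R) :
  nu1 a b t = gver (1 - a ^+ 2 - (b + a) ^+ 2) t.
Proof.
rewrite /nu1 /gver subr_eq0 subr_gt0 eq_sym.
by rewrite (_ : - (1 - a ^+ 2 - _) = (b + a) ^+ 2 + a ^+ 2 - 1); last by ring.
Qed.

Lemma eltM (R : realType) (C D : 'M[R]_3) (u v : R) :
  elt C u *m elt D v = elt (C *m D) (u + v).
Proof. by rewrite bdiagM -expRD. Qed.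

Lemma gamma1E (R : realType) (a1 a2 a3 b t : R) :
  gamma1 a1 a2 a3 b t =
  elt (exp_so21 a1 a3 (b + a2) t *m rot (- (b * t))) (a2 * t).
Proof.
rewrite /gamma1 expmx_generator.
(* the second factor is the exponential of a generator too *)
have -> : e4 = 0 *: e1 + 0 *: e2 + 0 *: e3 + 1 *: e4 :> 'M[R]_4.
  by rewrite !scale0r !add0r scale1r.
rewrite expmx_generator eltM exp_so21_rot mul0r addr0.
by rewrite addr0 mul1r [t * b]mulrC.
Qed.

(** The arccosine gives [phi] up to sign; the sign is that of [x]. *)
Lemma exists_phase (R : realType) (s x y : R) : 0 < s ->
  x ^+ 2 + y ^+ 2 = s ^+ 2 ->
  exists phi, x = s * sin phi /\ y = s * cos phi.
Proof.
move=> s0 xys; have sn0 : s != 0 by rewrite gt_eqF.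
have ysE : 1 - (y / s) ^+ 2 = (x / s) ^+ 2.
  by rewrite !expr_div_n -[x ^+ 2](addrK (y ^+ 2)) xys; field.
have ys1 : -1 <= y / s <= 1.
  rewrite -ler_norml -(@expr_le1 _ 2)// -normrX ger0_norm ?sqr_ge0//.
  by rewrite -subr_ge0 ysE sqr_ge0.
have yE : y = s * cos (acos (y / s)).
  by rewrite acosK ?in_itv// mulrC divfK.
have xE : `|x| = s * sin (acos (y / s)).
  by rewrite sin_acos// ysE sqrtr_sqr normrM normfV (gtr0_norm s0) mulrC divfK.
case: (leP 0 x) => x0.
  by exists (acos (y / s)); rewrite -yE -xE ger0_norm.
exists (- acos (y / s)).
by rewrite cosN sinN -yE mulrN -xE ltr0_norm// opprK.
Qed.

Theorem theorem9 (R : realType) (a1 a2 a3 b : R)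
    (ha : a1 ^+ 2 + a2 ^+ 2 + a3 ^+ 2 = 1) :
  (a2 != 1 -> a2 != -1 ->
     (exists phi0 : R, a1 = Num.sqrt (1 - a2 ^+ 2) * sin phi0
                    /\ a3 = Num.sqrt (1 - a2 ^+ 2) * cos phi0)
  /\ forall phi0 : R,
       a1 = Num.sqrt (1 - a2 ^+ 2) * sin phi0 ->
       a3 = Num.sqrt (1 - a2 ^+ 2) * cos phi0 ->
     forall t : R,
     let s := Num.sqrt (1 - a2 ^+ 2) in
     let mu := mu1 a2 b t in
     let nu := nu1 a2 b t in
     exists C : 'M[R]_3,
       [/\ in_SO021 C, gamma1 a1 a2 a3 b t = elt C (a2 * t) &
       [/\ col 0 C = vec3
             (1 + nu * (1 - a2 ^+ 2))
             (s * (mu * cos phi0 - (b + a2) * nu * sin phi0))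
             (s * (mu * sin phi0 + (b + a2) * nu * cos phi0)),
           col 1 C = vec3
             (s * (mu * cos (b * t + phi0)
                   + (b + a2) * nu * sin (b * t + phi0)))
             ((1 - (b + a2) ^+ 2 * nu) * cos (b * t)
              + (b + a2) * mu * sin (b * t)
              + (1 - a2 ^+ 2) * nu * cos (b * t + phi0) * cos phi0)
             (- (1 - (b + a2) ^+ 2 * nu) * sin (b * t)
              + (b + a2) * mu * cos (b * t)
              + (1 - a2 ^+ 2) * nu * cos (b * t + phi0) * sin phi0) &
           col 2 C = vec3
             (s * (mu * sin (b * t + phi0)
                   - (b + a2) * nu * cos (b * t + phi0)))
             ((1 - (b + a2) ^+ 2 * nu) * sin (b * t)
              - (b + a2) * mu * cos (b * t)
              + (1 - a2 ^+ 2) * nu * sin (b * t + phi0) * cos phi0)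
             ((1 - (b + a2) ^+ 2 * nu) * cos (b * t)
              + (b + a2) * mu * sin (b * t)
              + (1 - a2 ^+ 2) * nu * sin (b * t + phi0) * sin phi0)]])
  /\
  (a2 = 1 \/ a2 = -1 -> forall t : R,
     exists C : 'M[R]_3,
       [/\ in_SO021 C, gamma1 a1 a2 a3 b t = elt C (a2 * t) &
       [/\ col 0 C = vec3 1 0 0,
           col 1 C = vec3 0 (cos (a2 * t)) (sin (a2 * t)) &
           col 2 C = vec3 0 (- sin (a2 * t)) (cos (a2 * t))]]).
Proof.
split=> [a2_neq1 a2_neqN1|a2_pm1 t].
  have s2E : a1 ^+ 2 + a3 ^+ 2 = 1 - a2 ^+ 2 by rewrite -ha; ring.
  have s2_ge0 : 0 <= 1 - a2 ^+ 2 by rewrite -s2E addr_ge0 ?sqr_ge0.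
  have s_gt0 : 0 < Num.sqrt (1 - a2 ^+ 2).
    by rewrite sqrtr_gt0 lt_neqAle s2_ge0 eq_sym subr_eq0 eq_sym sqrf_eq1
      negb_or a2_neq1 a2_neqN1.
  have sqr_s := sqr_sqrtr s2_ge0.
  split=> [|phi0 a1E a3E t s mu nu].
    by apply: exists_phase => //; rewrite sqr_s.
  exists (exp_so21 a1 a3 (b + a2) t *m rot (- (b * t))).
  have [CJ C1] := unimodular_isometryM
    (exp_so21_isometry a1 a3 (b + a2) t) (rot_isometry (- (b * t))).
  have nu_ge0 : 0 <= nu by rewrite /nu nu1E gver_ge0.
  have muE : mu = gsin (a1 ^+ 2 + a3 ^+ 2 - (b + a2) ^+ 2) t.
    by rewrite /mu mu1E s2E.
  have nuE : nu = gver (a1 ^+ 2 + a3 ^+ 2 - (b + a2) ^+ 2) t.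
    by rewrite /nu nu1E s2E.
  have a13E := s2E.
  rewrite exp_so21E -muE -nuE {1}/rot mx3M in CJ C1 *.
  split; [split=> //| |].
  - by rewrite !mxE/= !mulr0 !addr0 mulr1 s2E ltr_wpDr// mulr_ge0.
  - by rewrite gamma1E exp_so21E -muE -nuE mx3M.
  rewrite -{}sqr_s -/s in a13E *.
  rewrite -/s in a1E a3E.
  rewrite a13E !(cosN, sinN) !(cosD, sinD) a1E a3E.
  by rewrite !col_mx3; split; congr vec3; ring.
have [-> ->] : a1 = 0 /\ a3 = 0.
  have a2_sqr : a2 ^+ 2 = 1 by apply/eqP; rewrite sqrf_eq1; apply/orP;
    case: a2_pm1 => ->; [left|right].
  have /eqP : a1 ^+ 2 + a3 ^+ 2 = 0 by move: ha; rewrite a2_sqr => ha0; lra.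
  by rewrite paddr_eq0 ?sqr_ge0// !sqrf_eq0 => /andP[/eqP-> /eqP->].
exists (rot (a2 * t)); split.
- by have [? ?] := rot_isometry (a2 * t); split=> //; rewrite mxE.
- by rewrite gamma1E exp_so21_rot rotM; congr (elt (rot _) _); ring.
- by rewrite !col_mx3.
Qed.
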